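(* Let the ternary operation $t$ have even (homological) degree, so that no Koszul signs occur, and let $\mathcal{LT}$ be the free nonsymmetric operad over a field of characteristic $0$ generated by $t$. Let $$\alpha = t\circ_1 t + t\circ_2 t + t\circ_3 t \in \mathcal{LT}(5),$$ and let $\langle\alpha\rangle$ be the operad ideal generated by $\alpha$. With respect to the path-lex monomial order, the following five tree polynomials form the reduced Gröbner basis for $\langle \alpha\rangle$: $$\alpha = t\circ_1 t + t\circ_2 t + t\circ_3 t,$$ $$\beta = t\circ_2(t\circ_3 t) + t\circ_3(t\circ_2 t) + t\circ_3(t\circ_3 t),$$ $$\eta = (t\circ_2 t)\circ_5(t\circ_2 t) + (t\circ_2 t)\circ_5(t\circ_3 t),$$ $$\theta = t\circ_3\big((t\circ_2 t)\circ_5 t\big),$$ $$\nu = t\circ_3(t\circ_3(t\circ_3 t)).$$ Equivalently, writing $({*}{*}{*})$ for $t$, as nonassociative polynomials: $\alpha = (({*}{*}{*}){*}{*})+({*}({*}{*}{*}){*})+({*}{*}({*}{*}{*}))$; $\beta = ({*}({*}{*}({*}{*}{*})){*})+({*}{*}({*}({*}{*}{*}){*}))+({*}{*}({*}{*}({*}{*}{*})))$; $\eta = ({*}({*}{*}{*})({*}({*}{*}{*}){*}))+({*}({*}{*}{*})({*}{*}({*}{*}{*})))$; $\theta = ({*}{*}({*}({*}{*}{*})({*}{*}{*})))$; $\nu = ({*}{*}({*}{*}({*}{*}({*}{*}{*}))))$.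
   Context: Trees. A ternary tree is a rooted plane tree in which every node has either no children (a leaf) or exactly $3$ children (an internal node). The weight $w(p)$ is the number of internal nodes; the arity $\ell(p)=1+2w(p)$ is the number of leaves, which are indexed $1,\dots,\ell(p)$ from left to right. The basic tree $t$ is the ternary tree of weight $1$. For odd $n\ge 1$, $\mathcal{T}(n)$ is the set of ternary trees of arity $n$, and $\mathcal{T}=\bigsqcup_n\mathcal{T}(n)$. For $p,q\in\mathcal{T}$ and $1\le i\le \ell(p)$, the partial composition $p\circ_i q$ is the tree obtained by identifying leaf $i$ of $p$ with the root of $q$. Free operad. $\mathcal{LT}(n)$ is the vector space (over a field of characteristic $0$) with basis $\mathcal{T}(n)$; $\mathcal{LT}=\bigoplus_n\mathcal{LT}(n)$, with partial compositions extended bilinearly. This is the free nonsymmetric operad generated by one ternary operation $t$ of even degree. Elements of $\mathcal{LT}(n)$ are called tree polynomials of arity $n$. The ideal $\langle f_1,\dots,f_k\rangle$ generated by tree polynomials $f_1,\dots,f_k$ is the intersection of all homogeneous (i.e. direct sum of arity components) subspaces $\mathcal{S}\subseteq\mathcal{LT}$ containing $f_1,\dots,f_k$ such that $f\in\mathcal{S}(m)$, $g\in\mathcal{LT}(n)$ imply $f\circ_i g,\ g\circ_j f\in\mathcal{S}$ for all $1\le i\le m$, $1\le j\le n$. Path-lex order. For $p\in\mathcal{T}(n)$, $\mathrm{path}(p)=(a_1,\dots,a_n)$ where $a_i$ is the length of the path from the root to leaf $i$; a tree is determined by its path sequence. For $p,q\in\mathcal{T}(n)$, $p\prec q$ means $\mathrm{path}(p)$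 precedes $\mathrm{path}(q)$ in lexicographic order of $n$-tuples. For nonzero $f\in\mathcal{LT}(n)$ the leading monomial $\ell m(f)$ is the greatest tree in path-lex order occurring in $f$ with nonzero coefficient. Divisibility and Gröbner bases. A tree $q$ is divisible by a tree $p$ ($p\mid q$) if $p$ is a subtree of $q$, i.e. $q$ can be obtained from $p$ by a sequence of partial compositions with other trees: there are a tree $r$, an index $i$, and trees $s_1,\dots,s_{\ell(p)}$ such that $q=r\circ_i p'$, where $p'$ is obtained by grafting $s_j$ onto leaf $j$ of $p$ for each $j$ (trivial one-vertex trees allowed). A finite set $G$ of nonzero tree polynomials is a Gröbner basis for $I=\langle G\rangle$ if for every nonzero $f\in I\cap\mathcal{LT}(n)$ (any $n$) there is $g\in G$ with $\ell m(g)\mid \ell m(f)$. A Gröbner basis $G$ is reduced if every $g\in G$ is monic (its leading monomial has coefficient $1$) and no tree occurring in $g$ with nonzero coefficient is divisible by $\ell m(h)$ for any $h\in G$, $h\ne g$. Every operad ideal has a unique reduced Gröbner basis. *)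

(* Defs.v *)
From HB Require Import structures.
From mathcomp Require Import all_boot all_order all_algebra.
From mathcomp Require Import finmap.
From mathcomp.multinomials Require Import monalg.

Set Implicit Arguments.
Unset Strict Implicit.
Unset Printing Implicit Defensive.

Import Order.TTheory GRing.Theory.

Local Open Scope fset_scope.
Local Open Scope ring_scope.

Inductive tree : Type := Leaf | Node of tree & tree & tree.

Fixpoint encode_tree (p : tree) : GenTree.tree void :=
  if p is Node a b c
  then GenTree.Node 1 [:: encode_tree a; encode_tree b; encode_tree c]
  else GenTree.Node 0 [::].

Fixpoint decode_tree (p : GenTree.tree void) : tree :=
  if p is GenTree.Node 1 [:: a; b; c]
  then Node (decode_tree a) (decode_tree b) (decode_tree c) else Leaf.

Lemma encode_treeK : cancel encode_tree decode_tree.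
Proof. by elim=> //= a -> b -> c ->. Qed.

HB.instance Definition _ := Countable.copy tree (can_type encode_treeK).

Fixpoint weight (p : tree) : nat :=
  if p is Node a b c then (weight a + weight b + weight c).+1 else 0%N.

Fixpoint arity (p : tree) : nat :=
  if p is Node a b c then (arity a + arity b + arity c)%N else 1%N.

Lemma arityE (p : tree) : arity p = (1 + 2 * weight p)%N.
Proof.
elim: p => //= a -> b -> c ->.
by rewrite mulnS !mulnDr !addnA -!addnA !(addnCA _ 1%N).
Qed.

Definition t : tree := Node Leaf Leaf Leaf.

(* Leaves are numbered from 1; the value is only meaningful when             *)
(* 1 <= i <= arity p.                                                        *)
Fixpoint tcomp (p : tree) (i : nat) (q : tree) : tree :=
  if p is Node a b c then
    if (i <= arity a)%N then Node (tcomp a i q) b c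
    else if (i <= arity a + arity b)%N then Node a (tcomp b (i - arity a) q) c
    else Node a b (tcomp c (i - (arity a + arity b)) q)
  else q.

Notation "p \o_( i ) q" := (tcomp p i q)
  (at level 40, left associativity, format "p  \o_( i )  q").

(* Simultaneous grafting of the j-th tree of s onto the j-th leaf of p,      *)
(* meaningful when size s = arity p.                                         *)
Fixpoint graft (p : tree) (s : seq tree) : tree :=
  if p is Node a b c then
    Node (graft a (take (arity a) s))
         (graft b (take (arity b) (drop (arity a) s)))
         (graft c (drop (arity a + arity b) s))
  else head Leaf s.

Definition divides (p q : tree) : Prop :=
  exists (r : tree) (i : nat) (s : seq tree),
    [/\ (1 <= i <= arity r)%N, size s = arity p & q = r \o_(i) graft p s].

Fixpoint tpath (p : tree) : seq nat :=
  if p is Node a b c then [seq d.+1 | d <- tpath a ++ tpath b ++ tpath c]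
  else [:: 0%N].

Definition path_lt (p q : tree) : bool :=
  ((tpath p : seqlexi nat) < (tpath q : seqlexi nat))%O.

Definition path_max (p q : tree) : tree := if path_lt p q then q else p.

Section FreeOperad.
Variable F : fieldType.

Local Notation LT := {malg F[tree]}.

Definition of_arity (n : nat) (f : LT) : bool :=
  all (fun p => arity p == n) (msupp f).

Definition component (n : nat) (f : LT) : LT :=
  \sum_(p <- msupp f | arity p == n) << f@_p *g p >>.

(* The bilinear extension of tcomp; t has even degree, hence no Koszul signs. *)
Definition pcomp (f : LT) (i : nat) (g : LT) : LT :=
  \sum_(p <- msupp f) \sum_(q <- msupp g) << f@_p * g@_q *g p \o_(i) q >>.

(* A subspace is homogeneous iff it contains the components of its elements. *)
Record operad_ideal (S : LT -> Prop) : Prop := OperadIdeal {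
  ideal0 : S 0;
  idealD : forall f g, S f -> S g -> S (f + g);
  idealZ : forall (c : F) f, S f -> S (c *: f);
  ideal_homogeneous : forall n f, S f -> S (component n f);
  ideal_compl : forall m n f g i, S f -> of_arity m f -> of_arity n g ->
    (1 <= i <= m)%N -> S (pcomp f i g);
  ideal_compr : forall m n f g j, S f -> of_arity m f -> of_arity n g ->
    (1 <= j <= n)%N -> S (pcomp g j f)
}.

Definition ideal_gen (G : {fset LT}) (f : LT) : Prop :=
  forall S : LT -> Prop, operad_ideal S -> (forall g, g \in G -> S g) -> S f.

(* Leaf, of path (0), lies below every other tree, so it does not affect the *)
(* maximum; lm 0 = Leaf is a junk value.                                     *)
Definition lm (f : LT) : tree := \big[path_max/Leaf]_(p <- msupp f) p.

Definition groebner_basis (G : {fset LT}) (I : LT -> Prop) : Prop :=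
  [/\ forall g, g \in G -> g != 0 /\ exists n, of_arity n g,
      forall f, I f <-> ideal_gen G f
    & forall n f, f != 0 -> I f -> of_arity n f ->
        exists2 g, g \in G & divides (lm g) (lm f)].

Definition reduced_groebner_basis (G : {fset LT}) (I : LT -> Prop) : Prop :=
  [/\ groebner_basis G I,
      forall g, g \in G -> g@_(lm g) = 1
    & forall g h p, g \in G -> h \in G -> h != g -> p \in msupp g ->
        ~ divides (lm h) p].

Definition alpha : LT := << t \o_(1) t >> + << t \o_(2) t >> + << t \o_(3) t >>.

Definition beta : LT :=
  << t \o_(2) (t \o_(3) t) >> + << t \o_(3) (t \o_(2) t) >>
  + << t \o_(3) (t \o_(3) t) >>.

Definition eta : LT :=
  << (t \o_(2) t) \o_(5) (t \o_(2) t) >>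
  + << (t \o_(2) t) \o_(5) (t \o_(3) t) >>.

Definition theta : LT := << t \o_(3) ((t \o_(2) t) \o_(5) t) >>.

Definition nu : LT := << t \o_(3) (t \o_(3) (t \o_(3) t)) >>.

End FreeOperad.

Arguments alpha {F}.
Arguments beta {F}.
Arguments eta {F}.
Arguments theta {F}.
Arguments nu {F}.

Lemma tpath_Node (a b c : tree) :
  exists d s, tpath (Node a b c) = d.+1 :: s.
Proof.
suff [d [s /= ->]] : exists d s, tpath a = d :: s by do 2!eexists.
elim: a => [|a [d [s /= ->]] b' _ c' _] /=; first by exists 0%N, [::].
by do 2!eexists.
Qed.

Lemma path_lt_Leaf (p : tree) : path_lt p Leaf = false.
Proof.
case: p => [|a b c]; first by rewrite /path_lt ltxx.
by have [d [s E]] := tpath_Node a b c; rewrite /path_lt E ltxi_cons.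
Qed.

(* The maximum defining lm is indeed the greatest tree occurring in f.       *)
Lemma lm_max (F : fieldType) (f : {malg F[tree]}) : f != 0 ->
  lm f \in msupp f /\ forall q, q \in msupp f -> ~~ path_lt (lm f) q.
Proof.
move=> nz; have s0 : enum_fset (msupp f) != [::].
  apply: contra nz => /eqP s0; rewrite (monalgE f) s0 big_nil //.
suff [mem_s max_s] : let M := \big[path_max/Leaf]_(p <- msupp f) p in
    M \in enum_fset (msupp f) /\
    forall q, q \in enum_fset (msupp f) -> ~~ path_lt M q.
  by split.
elim: (enum_fset _) s0 => //= p s IHs _; rewrite big_cons.
have [->|/IHs [mem_s max_s]] := eqVneq s [::].
  rewrite big_nil /path_max path_lt_Leaf mem_head; split=> // q.
  by rewrite inE => /eqP ->; rewrite /path_lt ltxx.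
rewrite /path_max; case: ifPn => lt_p.
  rewrite inE mem_s orbT; split=> // q; rewrite inE => /predU1P [->|/max_s //].
  by move: lt_p; rewrite /path_lt -leNgt => /ltW.
rewrite mem_head; split=> // q; rewrite inE => /predU1P [->|/max_s].
  by rewrite /path_lt ltxx.
by move: lt_p; rewrite /path_lt -!leNgt => le_p le_q; apply: le_trans le_q le_p.
Qed.

(* Main.v *)
From HB Require Import structures.
Require Import Defs.
From mathcomp Require Import all_boot all_order all_algebra.
From mathcomp Require Import finmap.
From mathcomp.multinomials Require Import monalg.
From mathcomp Require Import zify ring.

Import GRing.Theory.

Local Open Scope fset_scope.
Local Open Scope ring_scope.

(** The proof separates a lower bound on the ideal from an upper bound.

    Lower bound: beta, eta, theta and nu belong to the ideal of alpha because
    2 beta, 3 eta, 2 theta and 2 nu are explicit integer combinations of partial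
    compositions of trees with relations already obtained.  These
    combinations, which solve linear systems in weights 3 and 4, are checked by
    computation (certified, relations_in_ideal).  Characteristic 0 is what
    makes 2 and 3 invertible.

    Upper bound: no other leading monomials occur.  Write [b, c] for
    Node Leaf b c and L_n for the comb [..[[Leaf, Leaf], Leaf].., Leaf] with n
    internal nodes.  A tree in which none of the five leading monomials occurs
    is one of L_n, [Leaf, L_n], [Leaf, [Leaf, L_n]], [L_n, [Leaf, L_m]]
    (avoids_normal).  On the space with these trees as coordinates there is an
    explicit trilinear operation T that satisfies alpha identically
    (T_partially_associative); it is the product induced on normal forms.  The
    tree polynomials that vanish under all evaluations in this algebra form an
    operad ideal containing alpha (vanishing_ideal), hence the ideal of alpha
    is contained in it.  Evaluating a tree p at the generator Leaf gives a
    combination of normal trees that are at most p in the path-lex order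
    (below_value), with coefficient 1 at p if p is itself normal
    (value_diagonal).  So if the leading monomial of a nonzero f were normal,
    the coordinate of f at this tree would be its leading coefficient, and f
    would not vanish (lm_not_avoids). *)

Set Implicit Arguments.
Unset Strict Implicit.
Unset Printing Implicit Defensive.

(** * Grafting and divisibility of trees *)

Lemma arity_gt0 p : (0 < arity p)%N.
Proof. by rewrite arityE. Qed.

Lemma arity_tcomp p i q : (0 < i <= arity p)%N ->
  arity (p \o_(i) q) = (arity p + arity q).-1.
Proof.
elim: p i => [|a IHa b IHb c IHc] i //=.
move=> i_bnd; have [a0 b0 c0] := And3 (arity_gt0 a) (arity_gt0 b) (arity_gt0 c).
case: ifP => ia /=; first by rewrite IHa; lia.
by case: ifP => ib /=; [rewrite IHb; lia | rewrite IHc; lia].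
Qed.

Fixpoint root_matches (p q : tree) : bool :=
  match p, q with
  | Leaf, _ => true
  | Node a b c, Node x y z =>
      [&& root_matches a x, root_matches b y & root_matches c z]
  | Node _ _ _, Leaf => false
  end.

Fixpoint occurs (p q : tree) : bool :=
  root_matches p q ||
  (if q is Node x y z then [|| occurs p x, occurs p y | occurs p z] else false).

Lemma root_matchesP p q :
  reflect (exists2 s, size s = arity p & q = graft p s) (root_matches p q).
Proof.
apply: (iffP idP) => [|[s size_s ->]]; last first.
  elim: p s size_s => //= a IHa b IHb c IHc s size_s.
  by rewrite IHa ?IHb ?IHc //= ?size_take_min ?size_drop size_s; lia.
elim: p q => [|a IHa b IHb c IHc] [|x y z] //=.
- by exists [:: Leaf].
- by exists [:: Node x y z].
case/and3P => /IHa [sa size_a ->] /IHb [sb size_b ->] /IHc [sc size_c ->].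
exists (sa ++ sb ++ sc); first by rewrite !size_cat size_a size_b size_c addnA.
have -> : drop (arity a + arity b) (sa ++ sb ++ sc) = sc.
  by rewrite catA drop_size_cat // size_cat size_a size_b.
by rewrite take_size_cat // drop_size_cat // take_size_cat.
Qed.

Lemma dividesP p q : reflect (divides p q) (occurs p q).
Proof.
apply: (iffP idP) => [|[r [i [s [i_bnd size_s ->]]]]]; last first.
  have /root_matchesP : exists2 s', size s' = arity p & graft p s = graft p s'.
    by exists s.
  move: (graft p s) => {s size_s} q.
  elim: r i i_bnd => [|a IHa b IHb c IHc] i /= i_bnd match_q.
    by case: q match_q => [|x y z] /= ->.
  by case: ifP => ia /=; [|case: ifP => ib /=];
    rewrite ?IHa ?IHb ?IHc ?orbT //; lia.
have here q' : root_matches p q' -> divides p q'.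
  by case/root_matchesP => s size_s ->; exists Leaf, 1%N, s.
elim: q => [|x IHx y IHy z IHz] /=; first by rewrite orbF; apply: here.
case/orP => [/here //|/or3P [/IHx|/IHy|/IHz]] [r [i [s [i_bnd size_s ->]]]].
- exists (Node r y z), i, s; split=> //=; first by lia.
  by rewrite (_ : i <= arity r)%N //; lia.
- exists (Node x r z), (arity x + i)%N, s; split=> //=; first by lia.
  by rewrite ifF ?ifT ?addKn //; lia.
- exists (Node x y r), (arity x + arity y + i)%N, s; split=> //=; first by lia.
  by rewrite !ifF ?addKn //; lia.
Qed.

(** * The path-lex order *)

Lemma size_tpath p : size (tpath p) = arity p.
Proof. by elim: p => //= a <- b <- c <-; rewrite size_map !size_cat addnA. Qed.

Lemma lex_ltE (m n : nat) (s u : seq nat) :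
  ((m :: s : seqlexi nat) < (n :: u : seqlexi nat))%O =
  (m < n)%N || (m == n) && ((s : seqlexi nat) < (u : seqlexi nat))%O.
Proof.
rewrite Order.SeqLexiOrder.Exports.ltxi_cons !Order.NatOrder.leEnat.
by case: ltngtP => //= ->; rewrite eqxx.
Qed.

Lemma lex_lt_catl (s1 s2 u1 u2 : seq nat) : size s1 = size s2 ->
  ((s1 : seqlexi nat) < (s2 : seqlexi nat))%O ->
  ((s1 ++ u1 : seqlexi nat) < (s2 ++ u2 : seqlexi nat))%O.
Proof.
elim: s1 s2 => [|m s1 IH] [|n s2] //= [eq_size]; rewrite !lex_ltE.
by case/orP => [->//|/andP [/eqP -> /(IH _ eq_size) ->]]; rewrite eqxx orbT.
Qed.

Lemma lex_lt_catr (s u1 u2 : seq nat) :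
  ((s ++ u1 : seqlexi nat) < (s ++ u2 : seqlexi nat))%O =
  ((u1 : seqlexi nat) < (u2 : seqlexi nat))%O.
Proof. by elim: s => //= m s <-; rewrite lex_ltE ltnn eqxx. Qed.

Lemma lex_lt_mapS (s u : seq nat) :
  (([seq d.+1 | d <- s] : seqlexi nat) < ([seq d.+1 | d <- u] : seqlexi nat))%O =
  ((s : seqlexi nat) < (u : seqlexi nat))%O.
Proof. by elim: s u => [|m s IH] [|n u] //=; rewrite !lex_ltE ltnS eqSS IH. Qed.

(** The alternative to path_lt is equality of trees, not of path sequences,  *)
(** because a normal tree has to be identified with lm f in the end.         *)
Definition path_le (p q : tree) : Prop :=
  p = q \/ arity p = arity q /\ path_lt p q.

Lemma path_le_refl p : path_le p p.
Proof. by left. Qed.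

Lemma path_le_arity p q : path_le p q -> arity p = arity q.
Proof. by case=> [->|[]]. Qed.

Lemma path_le_trans p q r : path_le p q -> path_le q r -> path_le p r.
Proof.
case=> [->|[pq lt_pq]] // [<-|[qr lt_qr]]; first by right.
by right; split; [rewrite pq | apply: Order.POrderTheory.lt_trans lt_pq lt_qr].
Qed.

Lemma path_le_Node a b c x y z :
  path_le a x -> path_le b y -> path_le c z ->
  path_le (Node a b c) (Node x y z).
Proof.
case=> [->|[ax lt_ax]] le_by le_cz; last first.
  right; split; first by rewrite /= ax (path_le_arity le_by) (path_le_arity le_cz).
  by rewrite /path_lt /= lex_lt_mapS lex_lt_catl // !size_tpath.
case: le_by => [->|[byE lt_by]]; last first.
  right; split; first by rewrite /= byE (path_le_arity le_cz).
  by rewrite /path_lt /= lex_lt_mapS lex_lt_catr lex_lt_catl // !size_tpath.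
case: le_cz => [->|[cz lt_cz]]; [by left | right; split; first by rewrite /= cz].
by rewrite /path_lt /= lex_lt_mapS !lex_lt_catr.
Qed.

(** The first leaf already decides: its depth is 1 on the left and greater   *)
(** than 1 on the right.                                                     *)
Lemma path_le_first b c x y z : (1 < arity x)%N ->
  arity (Node Leaf b c) = arity (Node x y z) ->
  path_le (Node Leaf b c) (Node x y z).
Proof.
case: x => // x1 x2 x3 _ eq_ar; right; split=> //.
have [d [s E]] := tpath_Node x1 x2 x3.
by rewrite /path_lt; move: E => /= ->; rewrite lex_ltE.
Qed.

(** Either the first leaf decides, as above, or the second one does.         *)
Lemma path_le_second c x y z : (1 < arity y)%N ->
  arity (Node Leaf Leaf c) = arity (Node x y z) ->
  path_le (Node Leaf Leaf c) (Node x y z).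
Proof.
case: x => [|x1 x2 x3]; last first.
  move=> _; apply: path_le_first => /=.
  by have := arity_gt0 x1; have := arity_gt0 x2; lia.
case: y => // y1 y2 y3 _ eq_ar; right; split=> //.
have [d [s E]] := tpath_Node y1 y2 y3.
by rewrite /path_lt; move: E => /= ->; rewrite !lex_ltE.
Qed.

Section TreePolynomials.
Variable F : fieldType.
Local Notation LT := {malg F[tree]}.
Implicit Types (f g : LT) (h : tree -> F) (p q r : tree) (l : seq tree).

(** * Tree polynomials and linear functionals *)

(** The value at f of the linear functional on LT that extends h. Partial    *)
(** composition and the arity components are defined by sums over supports;  *)
(** testing them against functionals removes all reference to the supports.  *)
Definition pairing h f : F := mmap idfun h f.

Lemma pairingE h f : pairing h f = \sum_(p <- msupp f) f@_p * h p.
Proof. by []. Qed.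

Lemma pairing0 h : pairing h 0 = 0.
Proof. exact: raddf0. Qed.

Lemma pairingD h f g : pairing h (f + g) = pairing h f + pairing h g.
Proof. exact: raddfD. Qed.

Lemma pairingU h c p : pairing h << c *g p >> = c * h p.
Proof. exact: mmapU. Qed.

Lemma pairing_sum h (I : Type) (s : seq I) (P : pred I) (E : I -> LT) :
  pairing h (\sum_(i <- s | P i) E i) = \sum_(i <- s | P i) pairing h (E i).
Proof. exact: raddf_sum. Qed.

Lemma pairingZ h c f : pairing h (c *: f) = c * pairing h f.
Proof.
rewrite [pairing h f]pairingE mulr_sumr {1}[f]monalgE scaler_sumr pairing_sum.
apply: eq_bigr => p _.
suff -> : c *: << f@_p *g p >> = << c * f@_p *g p >> by rewrite pairingU mulrA.
by apply/malgP => k; rewrite mcoeffZ !mcoeffU mulrnAr.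
Qed.

Lemma eq_pairing h1 h2 f : {in msupp f, h1 =1 h2} -> pairing h1 f = pairing h2 f.
Proof.
by move=> eq_h; rewrite !pairingE; apply: eq_big_seq => p /eq_h ->.
Qed.

Lemma pairing_coef f p : pairing (fun q => (q == p)%:R) f = f@_p.
Proof.
rewrite {2}[f]monalgE raddf_sum pairingE.
by apply: eq_bigr => q _; rewrite /= mcoeffU mulr_natr.
Qed.

Lemma pairing_component h n f :
  pairing h (component n f) = pairing (fun p => (arity p == n)%:R * h p) f.
Proof.
rewrite pairing_sum pairingE big_mkcond; apply: eq_bigr => p _ /=.
by case: ifP => _; rewrite ?mul0r ?mulr0 // pairingU mul1r.
Qed.

Lemma pairing_pcomp h f i g :
  pairing h (Defs.pcomp f i g) =
  pairing (fun p => pairing (fun q => h (p \o_(i) q)) g) f.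
Proof.
rewrite pairing_sum [RHS]pairingE; apply: eq_bigr => p _.
rewrite pairing_sum pairingE mulr_sumr; apply: eq_bigr => q _.
by rewrite pairingU mulrA.
Qed.

Lemma of_arityP n f : reflect {in msupp f, forall p, arity p = n} (of_arity n f).
Proof.
by apply: (iffP allP) => ar p /ar; [move/eqP | move=> ->].
Qed.

Lemma of_arity_tree p : of_arity (arity p) (<< p >> : LT).
Proof.
by apply/of_arityP => q /(fsubsetP msuppU_le); rewrite in_fset1 => /eqP ->.
Qed.

Definition tree_sum l : LT := \sum_(p <- l) << p >>.

Lemma pairing_tree_sum h l : pairing h (tree_sum l) = \sum_(p <- l) h p.
Proof. by rewrite pairing_sum; apply: eq_bigr => p _; rewrite pairingU mul1r. Qed.

Lemma tree_sum_coef l p : (tree_sum l)@_p = (count_mem p l)%:R.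
Proof.
rewrite -pairing_coef pairing_tree_sum -sum1_count natr_sum [RHS]big_mkcond /=.
by apply: eq_bigr => q _; case: eqP.
Qed.

Lemma tree_sum_arity n l : {in l, forall p, arity p = n} -> of_arity n (tree_sum l).
Proof.
move=> ar_l; apply/of_arityP => p; rewrite -mcoeff_neq0 tree_sum_coef => nz_p.
by apply: ar_l; rewrite -has_pred1 has_count; case: (count _ _) nz_p; rewrite ?eqxx.
Qed.

Lemma pcomp_treel r i l :
  Defs.pcomp << r >> i (tree_sum l) = tree_sum [seq r \o_(i) p | p <- l].
Proof.
apply/malgP => k; rewrite -!pairing_coef pairing_pcomp pairingU mul1r.
by rewrite !pairing_tree_sum big_map.
Qed.

Lemma pcomp_treer l i q :
  Defs.pcomp (tree_sum l) i << q >> = tree_sum [seq p \o_(i) q | p <- l].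
Proof.
apply/malgP => k; rewrite -!pairing_coef pairing_pcomp !pairing_tree_sum big_map.
by apply: eq_bigr => p _; rewrite pairingU mul1r.
Qed.

(** Multiplicities in l do not cancel in characteristic 0. *)
Lemma msupp_tree_sum (charF0 : [pchar F] =i pred0) l p :
  (p \in msupp (tree_sum l)) = (p \in l).
Proof.
rewrite -mcoeff_neq0 tree_sum_coef -has_pred1 has_count.
by have /pcharf0P -> := charF0; rewrite lt0n.
Qed.

Lemma lm_tree_sum (charF0 : [pchar F] =i pred0) p l :
  all (fun q => (q == p) || path_lt q p) l -> lm (tree_sum (p :: l)) = p.
Proof.
move=> /allP max_p; have nz : tree_sum (p :: l) != 0.
  apply/eqP => /(congr1 (fun f => p \in msupp f)).
  by rewrite msupp_tree_sum // mem_head msupp0 in_fset0.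
have [] := lm_max nz; rewrite msupp_tree_sum // inE => /predU1P [//|/max_p].
case/predU1P => // lt_p max_lm; have := max_lm p.
by rewrite msupp_tree_sum // mem_head lt_p => /(_ isT).
Qed.

(** * Certified membership in an operad ideal *)

Definition equiarity l : bool := all (fun p => arity p == arity (head Leaf l)) l.

(** One summand of a certificate: coef times the relation obtained from the  *)
(** sum of relator by grafting the trees args onto its leaves, one after the *)
(** other, and then inserting the result at leaf slot of the tree ctx.       *)
Record summand := Summand {
  coef : int; ctx : tree; slot : nat; relator : seq tree; args : seq (nat * tree)
}.

Definition summand_data (x : summand) := (coef x, ctx x, slot x, relator x, args x).

Lemma summand_dataK : cancel summand_data
  (fun d => let: (c, r, i, l, qs) := d in Summand c r i l qs).
Proof. by case. Qed.

HB.instance Definition _ := Equality.copy summand (can_type summand_dataK).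

Definition graft_args (p : tree) (qs : seq (nat * tree)) : tree :=
  foldl (fun p iq => p \o_(iq.1) iq.2) p qs.

Fixpoint graftable (n : nat) (qs : seq (nat * tree)) : bool :=
  if qs is (i, q) :: qs'
  then (0 < i <= n)%N && graftable (n + arity q).-1 qs' else true.

Definition expansion (x : summand) : seq tree :=
  [seq ctx x \o_(slot x) graft_args p (args x) | p <- relator x].

Definition valid_summand (rels : seq (seq tree)) (x : summand) : bool :=
  [&& relator x \in rels, (0 < slot x <= arity (ctx x))%N
    & graftable (arity (head Leaf (relator x))) (args x)].

Definition total_coef (p : tree) (xs : seq summand) : int :=
  foldr (fun x => +%R (coef x * (count_mem p (expansion x))%:Z)) 0 xs.

Definition certifies (rels : seq (seq tree)) (n : nat) l (xs : seq summand) :=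
  all (valid_summand rels) xs &&
  all (fun p => (n * count_mem p l)%:Z
                == total_coef p xs)
    (l ++ flatten (map expansion xs)).

Section Membership.
Variable S : LT -> Prop.
Hypothesis idealS : operad_ideal S.

Lemma ideal_graft_args n l qs : S (tree_sum l) ->
  {in l, forall p, arity p = n} -> graftable n qs ->
  exists m, S (tree_sum [seq graft_args p qs | p <- l]) /\
            {in [seq graft_args p qs | p <- l], forall p, arity p = m}.
Proof.
elim: qs n l => [|[i q] qs IH] n l Sl ar_l /=.
  by exists n; rewrite (_ : map _ l = l) //; elim: l {Sl ar_l} => //= p l ->.
case/andP => i_bnd gr_qs.
have ar_l' : {in [seq p \o_(i) q | p <- l],
    forall p, arity p = (n + arity q).-1}.
  by move=> _ /mapP [p /ar_l arp ->]; rewrite arity_tcomp arp.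
have Sl' : S (tree_sum [seq p \o_(i) q | p <- l]).
  rewrite -pcomp_treer; apply: (ideal_compl idealS Sl (tree_sum_arity ar_l)) i_bnd.
  by apply: (of_arity_tree q).
have [m] := IH _ _ Sl' ar_l' gr_qs.
by rewrite -map_comp; exists m.
Qed.

Lemma ideal_expansion x rels :
  {in rels, forall l, S (tree_sum l)} -> all equiarity rels ->
  valid_summand rels x -> S (tree_sum (expansion x)).
Proof.
move=> Srels /allP eq_ar /and3P [relator_x slot_bnd gr_x].
have ar_x : {in relator x, forall p, arity p = arity (head Leaf (relator x))}.
  by move=> p p_x; apply/eqP; have /allP := eq_ar _ relator_x; apply.
have [n [Sx ar_n]] := ideal_graft_args (Srels _ relator_x) ar_x gr_x.
rewrite /expansion (map_comp (tcomp (ctx x) (slot x)) (graft_args^~ (args x))).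
rewrite -pcomp_treel.
apply: (ideal_compr idealS Sx (tree_sum_arity ar_n) _ slot_bnd).
exact: of_arity_tree.
Qed.

(** Both sides of the certified identity have integer coefficients, which    *)
(** are compared on the finitely many trees that occur in it.                *)
Lemma certified rels n l xs :
  {in rels, forall l', S (tree_sum l')} -> all equiarity rels ->
  n%:R != 0 :> F -> certifies rels n l xs -> S (tree_sum l).
Proof.
move=> Srels eq_ar nz_n /andP [/allP valid_xs /allP check].
have -> : tree_sum l =
    n%:R^-1 *: \sum_(x <- xs) (coef x)%:~R *: tree_sum (expansion x).
  apply: (scalerI nz_n); rewrite scalerA mulfV // scale1r.
  apply/malgP => p; rewrite mcoeffZ tree_sum_coef -pairing_coef pairing_sum.
  under eq_bigr => x _ do rewrite pairingZ pairing_coef tree_sum_coef 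
    -[_%:R]/((Posz _)%:~R) -intrM.
  rewrite -[LHS]natrM -[LHS]/((Posz _)%:~R) -(rmorph_sum (intr : int -> F)) /=.
  have -> : \sum_(x <- xs) coef x * (count_mem p (expansion x))%:Z
      = total_coef p xs.
    by elim: (xs) => [|x xs' IH] /=; rewrite ?big_nil // big_cons IH.
  congr (_%:~R).
  have [/check /eqP //|] := boolP (p \in l ++ flatten (map expansion xs)).
  rewrite mem_cat negb_or => /andP [p_l p_xs].
  rewrite (count_memPn p_l) muln0.
  elim: (xs) p_xs => //= x xs'; rewrite mem_cat negb_or => IH /andP [p_x /IH <-].
  by rewrite (count_memPn p_x) mulr0.
apply: (idealZ idealS); rewrite big_seq.
apply: (big_ind S) => [|f g|x x_xs]; [exact: ideal0 | exact: idealD |].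
by apply: (idealZ idealS); apply: ideal_expansion eq_ar (valid_xs _ x_xs).
Qed.

End Membership.

(** * The five relations *)

(** Each list starts with the leading term; later lemmas read it off with    *)
(** head Leaf.                                                               *)
Definition alpha_terms := [:: t \o_(1) t; t \o_(2) t; t \o_(3) t].

Definition beta_terms :=
  [:: t \o_(2) (t \o_(3) t); t \o_(3) (t \o_(2) t); t \o_(3) (t \o_(3) t)].

Definition eta_terms :=
  [:: (t \o_(2) t) \o_(5) (t \o_(2) t); (t \o_(2) t) \o_(5) (t \o_(3) t)].

Definition theta_terms := [:: t \o_(3) ((t \o_(2) t) \o_(5) t)].

Definition nu_terms := [:: t \o_(3) (t \o_(3) (t \o_(3) t))].

Definition relations :=
  [:: alpha_terms; beta_terms; eta_terms; theta_terms; nu_terms].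

Lemma tree_sum1 p : tree_sum [:: p] = << p >>.
Proof. exact: big_seq1. Qed.

Lemma tree_sum2 p q : tree_sum [:: p; q] = << p >> + << q >>.
Proof. by rewrite /tree_sum big_cons big_seq1. Qed.

Lemma tree_sum3 p q r : tree_sum [:: p; q; r] = << p >> + << q >> + << r >>.
Proof. by rewrite /tree_sum !big_cons big_nil addr0 addrA. Qed.

Lemma relationsE :
  [:: alpha; beta; eta; theta; nu] = [seq tree_sum l | l <- relations].
Proof. by rewrite /= !tree_sum3 tree_sum2 !tree_sum1. Qed.

Lemma in_fset5 (T : choiceType) (x a b c d e : T) :
  (x \in [fset a; b; c; d; e]) = (x \in [:: a; b; c; d; e]).
Proof. by rewrite !inE -!orbA. Qed.

Lemma mem_relations f :
  reflect (exists2 l, l \in relations & f = tree_sum l)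
          (f \in [fset alpha; beta; eta; theta; nu]).
Proof. by rewrite in_fset5 relationsE; apply: mapP. Qed.

(** The eight partial compositions of alpha with t are linearly independent, *)
(** so the coefficients are forced, and the factor 2 is unavoidable.         *)
Definition beta_certificate : seq summand :=
  [:: Summand 1 Leaf 1 alpha_terms [:: (5, t)];
      Summand 1 Leaf 1 alpha_terms [:: (4, t)];
      Summand (-1) Leaf 1 alpha_terms [:: (3, t)];
      Summand (-1) Leaf 1 alpha_terms [:: (2, t)];
      Summand (-1) Leaf 1 alpha_terms [:: (1, t)];
      Summand 1 t 1 alpha_terms [::];
      Summand 1 t 2 alpha_terms [::];
      Summand 1 t 3 alpha_terms [::]]%N.

(** In weight 4 the compositions of alpha and beta are linearly dependent;   *)
(** of the possible certificates, the next three were chosen to have a small *)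
(** sum of absolute values of the coefficients.                              *)
Definition eta_certificate : seq summand :=
  [:: Summand 1 Leaf 1 alpha_terms [:: (5, t \o_(3) t)];
      Summand 1 Leaf 1 alpha_terms [:: (5, t \o_(2) t)];
      Summand (-1) Leaf 1 alpha_terms [:: (5, t \o_(1) t)];
      Summand 1 Leaf 1 alpha_terms [:: (4, t \o_(3) t)];
      Summand (-1) Leaf 1 alpha_terms [:: (4, t \o_(2) t)];
      Summand (-1) Leaf 1 alpha_terms [:: (4, t \o_(1) t)];
      Summand 1 (t \o_(2) t) 5 alpha_terms [::];
      Summand 1 (t \o_(1) t) 4 alpha_terms [::];
      Summand 1 (t \o_(1) t) 5 alpha_terms [::];
      Summand (-1) t 2 alpha_terms [:: (5, t)];
      Summand (-1) t 3 alpha_terms [:: (5, t)];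
      Summand (-1) t 3 alpha_terms [:: (4, t)];
      Summand 1 Leaf 1 beta_terms [:: (5, t)];
      Summand 1 Leaf 1 beta_terms [:: (4, t)];
      Summand 1 Leaf 1 beta_terms [:: (3, t)];
      Summand 1 Leaf 1 beta_terms [:: (2, t)];
      Summand (-2) Leaf 1 beta_terms [:: (1, t)]]%N.

Definition theta_certificate : seq summand :=
  [:: Summand 1 t 2 alpha_terms [:: (5, t)];
      Summand 1 t 3 alpha_terms [:: (5, t)];
      Summand 1 t 3 alpha_terms [:: (4, t)];
      Summand (-1) (t \o_(3) t) 4 alpha_terms [::];
      Summand (-1) (t \o_(2) t) 4 alpha_terms [::];
      Summand (-1) (t \o_(3) t) 5 alpha_terms [::];
      Summand 1 Leaf 1 beta_terms [:: (5, t)];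
      Summand 1 Leaf 1 beta_terms [:: (4, t)];
      Summand (-1) Leaf 1 beta_terms [:: (3, t)];
      Summand (-1) Leaf 1 beta_terms [:: (2, t)];
      Summand 1 Leaf 1 eta_terms [::]]%N.

Definition nu_certificate : seq summand :=
  [:: Summand 1 Leaf 1 alpha_terms [:: (5, t \o_(3) t)];
      Summand 1 Leaf 1 alpha_terms [:: (4, t); (3, t)];
      Summand 1 Leaf 1 alpha_terms [:: (4, t); (2, t)];
      Summand 1 Leaf 1 alpha_terms [:: (4, t); (1, t)];
      Summand (-1) (t \o_(2) t) 1 alpha_terms [::];
      Summand 1 t 3 alpha_terms [:: (5, t)];
      Summand (-1) Leaf 1 beta_terms [:: (3, t)];
      Summand (-1) Leaf 1 beta_terms [:: (2, t)];
      Summand (-1) Leaf 1 beta_terms [:: (1, t)];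
      Summand (-1) Leaf 1 theta_terms [::]]%N.

Lemma relations_in_ideal (charF0 : [pchar F] =i pred0) (S : LT -> Prop) :
  operad_ideal S -> S alpha -> {in relations, forall l, S (tree_sum l)}.
Proof.
move=> idealS S_alpha.
have nz n : n.+1%:R != 0 :> F by have /pcharf0P -> := charF0.
have Sa : {in [:: alpha_terms], forall l, S (tree_sum l)}.
  by move=> l; rewrite inE => /eqP ->; rewrite tree_sum3.
have extend l rels n xs : {in rels, forall l, S (tree_sum l)} ->
    all equiarity rels -> certifies rels n.+1 l xs ->
    {in rcons rels l, forall l, S (tree_sum l)}.
  move=> Srels eq_ar cert l'; rewrite mem_rcons inE => /predU1P [->|];
    last exact: Srels.
  exact: certified (nz n) cert.
have Sb := extend beta_terms _ 1%N beta_certificate Sa isT.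
have Se := extend eta_terms _ 2%N eta_certificate (Sb _) isT.
have St := extend theta_terms _ 1%N theta_certificate (Se _ _) isT.
have Sn := extend nu_terms _ 1%N nu_certificate (St _ _ _) isT.
by apply: Sn; vm_compute.
Qed.

(** * A partially associative algebra on the normal trees *)

Inductive normal : Type :=
  NA of nat | NB of nat | NC of nat | ND of nat & nat.

Fixpoint comb (n : nat) : tree :=
  if n is n'.+1 then Node Leaf (comb n') Leaf else Leaf.

Definition normal_tree (i : normal) : tree :=
  match i with
  | NA n => comb n
  | NB n => Node Leaf Leaf (comb n.+1)
  | NC n => Node Leaf Leaf (Node Leaf Leaf (comb n.+1))
  | ND n m => Node Leaf (comb n.+1) (Node Leaf Leaf (comb m))
  end.

Local Notation V := (normal -> F).
Implicit Types (u v w : V).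

(** P and Q are the coordinates of weight n of v along the combs and, for    *)
(** n >= 2, along the trees [Leaf, L_(n-1)].  Up to sign, these two kinds of *)
(** trees have the same effect in several slots of a product; R is the       *)
(** functional that measures this common effect.                             *)
Definition P v n : F := v (NA n).
Definition Q v n : F := if n is n'.+2 then v (NB n') else 0.
Definition R v n : F := if n is n'.+1 then (-1) ^+ n' * P v n + Q v n else 0.

Arguments P : simpl never.
Arguments Q : simpl never.
Arguments R : simpl never.

(** The normal form of Node u v w, extended trilinearly.  Every term has the *)
(** coordinate P _ 0 of some argument along Leaf as a factor: a product of   *)
(** three normal trees other than Leaf is zero.  The trees of the families   *)
(** NC and ND have zero products with everything.                            *)
Definition T u v w (i : normal) : F :=
  match i with
  | NA 0 => 0
  | NA n.+1 => P u 0 * P v n * P w 0 - R u n * P v 0 * P w 0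
  | NB n =>
      P u 0 * P v 0 * P w n.+1 - P u 0 * Q v n.+1 * P w 0
      - (-1) ^+ n * (R u n.+1 * P v 0 * P w 0)
  | NC n =>
      P u 0 * P v 0 * Q w n.+2 - (-1) ^+ n * (P u 0 * Q v n.+2 * P w 0)
      + R u n.+2 * P v 0 * P w 0
      - P u 1 * P v 0 * P w n.+1 + P u 1 * R v n.+1 * P w 0
  | ND n m =>
      P u 0 * P v n.+1 * R w m.+1
      - R u n.+1 * P v 0 * R w m.+1 - P u n.+2 * P v 0 * P w m
      + P u n.+2 * R v m * P w 0
  end.

Lemma R_0 v : R v 0 = 0.
Proof. by []. Qed.

Lemma R_S v n : R v n.+1 = (-1) ^+ n * P v n.+1 + Q v n.+1.
Proof. by []. Qed.

Lemma sign_cases n : (-1) ^+ n = 1 :> F \/ (-1) ^+ n = -1 :> F.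
Proof. by rewrite -signr_odd; case: (odd n); [right | left]. Qed.

Lemma P_T0 u v w : P (T u v w) 0 = 0.
Proof. by []. Qed.

Lemma P_TS u v w n :
  P (T u v w) n.+1 = P u 0 * P v n * P w 0 - R u n * P v 0 * P w 0.
Proof. by []. Qed.

Lemma Q_TSS u v w n :
  Q (T u v w) n.+2 = P u 0 * P v 0 * P w n.+1 - P u 0 * Q v n.+1 * P w 0
      - (-1) ^+ n * (R u n.+1 * P v 0 * P w 0).
Proof. by []. Qed.

(** The contributions of R u to the two coordinates combined in R cancel. *)
Lemma R_TS u v w n :
  R (T u v w) n.+1 = P u 0 * P v 0 * P w n - P u 0 * R v n * P w 0.
Proof.
case: n => [|n]; rewrite {1}/R P_TS.
  by rewrite /R /Q; ring.
by rewrite Q_TSS /R exprS; case: (sign_cases n) => ->; ring.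
Qed.

(** Once P, Q and R of the inner products are expressed by those of the      *)
(** factors, each coordinate is a polynomial identity; for NB and NC it also *)
(** uses that the signs square to 1.                                         *)
Lemma T_partially_associative a b c d e i :
  T (T a b c) d e i + T a (T b c d) e i + T a b (T c d e) i = 0.
Proof.
case: i => [[|n]|n|n|n m] /=; rewrite ?P_T0 ?P_TS ?R_TS ?addr0 //.
- by case: n => [|n]; rewrite ?P_T0 ?P_TS ?R_TS ?R_0; ring.
- case: n => [|n]; first by rewrite ?P_T0 ?P_TS ?Q_TSS /R /Q; ring.
  rewrite ?P_T0 ?P_TS ?Q_TSS ?R_TS !R_S !exprS.
  by case: (sign_cases n) => ->; ring.
- rewrite !Q_TSS !R_0 !R_S !exprS.
  by case: (sign_cases n) => ->; ring.
- by case: m => [|m]; rewrite ?P_T0 ?P_TS ?R_TS ?R_0; ring.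
Qed.

(** Linearity is stated pointwise, so that it also says that K respects      *)
(** pointwise equality.                                                      *)
Definition combines u (k : F) v w : Prop := forall i, u i = k * v i + w i.

Definition linear_map (K : V -> V) : Prop :=
  forall u k v w, combines u k v w -> combines (K u) k (K v) (K w).

Lemma coordinates_combine u k v w : combines u k v w -> forall n,
  [/\ P u n = k * P v n + P w n, Q u n = k * Q v n + Q w n
    & R u n = k * R v n + R w n].
Proof.
move=> uE; have PE n : P u n = k * P v n + P w n by exact: uE.
have QE n : Q u n = k * Q v n + Q w n.
  by case: n => [|[|n]]; rewrite /Q ?uE ?mulr0 ?addr0.
by move=> n; split=> //; case: n => [|n]; rewrite /R ?PE ?QE; ring.
Qed.

Lemma T_linear :
  [/\ forall b c, linear_map (fun a => T a b c),
      forall a c, linear_map (fun b => T a b c)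
    & forall a b, linear_map (fun c => T a b c)].
Proof.
split=> x y u k v w /coordinates_combine E;
  have PE n : P u n = k * P v n + P w n by [case: (E n)];
  have QE n : Q u n = k * Q v n + Q w n by [case: (E n)];
  have RE n : R u n = k * R v n + R w n by [case: (E n)];
  by case=> [[|n]|n|n|n m]; rewrite /T ?PE ?QE ?RE; ring.
Qed.

Lemma linear_map_comp K L :
  linear_map K -> linear_map L -> linear_map (fun v => K (L v)).
Proof. by move=> linK linL u k v w uE; apply/linK/linL. Qed.

Lemma linear_map0 K u : linear_map K -> (forall i, u i = 0) ->
  forall i, K u i = 0.
Proof.
move=> linK u0 i; have := linK u 1 u u _ i; rewrite mul1r => K0.
by apply: (addrI (K u i)); rewrite addr0 -K0 // => j; rewrite !u0 mulr0 addr0.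
Qed.

Lemma linear_map_pairing K (e : tree -> V) f i : linear_map K ->
  pairing (fun q => K (e q) i) f = K (fun j => pairing (fun q => e q j) f) i.
Proof.
move=> linK; rewrite pairingE.
pose sum (l : seq tree) j := \sum_(q <- l) f@_q * e q j.
rewrite -/(sum (msupp f)); elim: (enum_fset _) => [|q r IH].
  by rewrite big_nil linear_map0 // => j; rewrite /sum big_nil.
rewrite big_cons IH; symmetry; apply: linK => j.
by rewrite /sum big_cons.
Qed.

(** * Evaluating trees in the algebra *)

Fixpoint eval (p : tree) (s : seq V) : V :=
  if p is Node a b c then
    T (eval a (take (arity a) s))
      (eval b (take (arity b) (drop (arity a) s)))
      (eval c (drop (arity a + arity b) s))
  else head (fun _ => 0) s.

Lemma eval_Node a b c sa sb sc : size sa = arity a -> size sb = arity b ->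
  eval (Node a b c) (sa ++ sb ++ sc) = T (eval a sa) (eval b sb) (eval c sc).
Proof.
move=> size_a size_b /=; have -> : drop (arity a + arity b) (sa ++ sb ++ sc) = sc.
  by rewrite catA drop_size_cat // size_cat size_a size_b.
by rewrite take_size_cat // drop_size_cat // take_size_cat.
Qed.

Lemma split_size (A : Type) (s : seq A) m n : size s = (m + n)%N ->
  exists s1 s2, [/\ s = s1 ++ s2, size s1 = m & size s2 = n].
Proof.
move=> size_s; exists (take m s), (drop m s).
by rewrite cat_take_drop size_take_min size_drop size_s; split=> //; lia.
Qed.

(** Both sides of the ideal property rest on this: with the other arguments  *)
(** fixed, evaluation is linear in the argument at leaf i, and grafting q    *)
(** there substitutes the value of q for that argument.                      *)
Lemma eval_slot p i s1 s3 : (0 < i <= arity p)%N ->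
  size s1 = i.-1 -> size s3 = (arity p - i)%N ->
  exists K, [/\ linear_map K, forall v, eval p (s1 ++ v :: s3) = K v
    & forall q s2, size s2 = arity q ->
        eval (p \o_(i) q) (s1 ++ s2 ++ s3) = K (eval q s2)].
Proof.
have [lin1 lin2 lin3] := T_linear.
elim: p i s1 s3 => [|a IHa b IHb c IHc] i s1 s3; rewrite [arity _]/=.
  move=> i_bnd size1 size3.
  have [-> ->] : s1 = [::] /\ s3 = [::] by split; apply: size0nil; lia.
  by exists id; split=> // q s2 _; rewrite cats0.
move=> i_bnd size1 size3; case: (leqP i (arity a)) => ia.
  have [|s3a [sbc [-> size3a size_bc]]] :=
    @split_size _ s3 (arity a - i) (arity b + arity c); first by lia.
  have [sb [sc [-> size_b size_c]]] := split_size size_bc.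
  have [|//|//|K [linK evK subK]] := IHa i s1 s3a; first by lia.
  exists (fun v => T (K v) (eval b sb) (eval c sc)); split.
  - exact: (linear_map_comp (lin1 _ _)).
  - move=> v; rewrite -evK -eval_Node -?catA //.
    by rewrite size_cat /= size1 size3a; lia.
  - move=> q s2 size2; rewrite -subK // (_ : tcomp _ _ _ = Node (a \o_(i) q) b c).
      rewrite -eval_Node -?catA //.
      by rewrite !size_cat size1 size2 size3a arity_tcomp; lia.
    by rewrite /= ia.
case: (leqP i (arity a + arity b)) => ib.
  have [|sa [s1b [-> size_a size1b]]] :=
    @split_size _ s1 (arity a) (i - arity a).-1; first by lia.
  have [|s3b [sc [-> size3b size_c]]] :=
    @split_size _ s3 (arity b - (i - arity a)) (arity c); first by lia.
  have [|//|//|K [linK evK subK]] := IHb (i - arity a)%N s1b s3b; first by lia.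
  exists (fun v => T (eval a sa) (K v) (eval c sc)); split.
  - exact: (linear_map_comp (lin2 _ _)).
  - move=> v; rewrite -evK -eval_Node -?catA //.
    by rewrite size_cat /= size1b size3b; lia.
  - move=> q s2 size2.
    rewrite -subK // (_ : tcomp _ _ _ = Node a (b \o_(i - arity a) q) c).
      rewrite -eval_Node -?catA //.
      by rewrite !size_cat size1b size2 size3b arity_tcomp; lia.
    by rewrite /= leqNgt ia ib.
have [|sa [s1bc [-> size_a size1bc]]] :=
  @split_size _ s1 (arity a) (arity b + (i - (arity a + arity b)).-1);
  first by lia.
have [sb [s1c [-> size_b size1c]]] := split_size size1bc.
have [|//||K [linK evK subK]] := IHc (i - (arity a + arity b))%N s1c s3;
  [lia | lia |].
exists (fun v => T (eval a sa) (eval b sb) (K v)); split.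
- exact: (linear_map_comp (lin3 _ _)).
- by move=> v; rewrite -evK -eval_Node // -!catA.
- move=> q s2 size2.
  rewrite -subK // (_ : tcomp _ _ _ = Node a b (c \o_(i - (arity a + arity b)) q)).
    by rewrite -eval_Node // -!catA.
  by rewrite /= leqNgt ia leqNgt ib.
Qed.

(** The size of s selects one arity component of f, which makes this set of  *)
(** tree polynomials homogeneous.                                            *)
Definition vanishing f : Prop := forall s i,
  pairing (fun p => (arity p == size s)%:R * eval p s i) f = 0.

Lemma pairing_exchange (H : tree -> tree -> F) f g :
  pairing (fun p => pairing (H p) g) f = pairing (fun q => pairing (H^~ q) f) g.
Proof.
rewrite !pairingE; under eq_bigr => p _ do rewrite pairingE mulr_sumr.
rewrite exchange_big; apply: eq_bigr => q _; rewrite pairingE mulr_sumr.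
by apply: eq_bigr => p _; rewrite mulrCA.
Qed.

Lemma pairing_eq0 h f : {in msupp f, forall p, h p = 0} -> pairing h f = 0.
Proof.
by move=> h0; rewrite pairingE big_seq big1 // => p /h0 ->; rewrite mulr0.
Qed.

Lemma vanishing_pcompl m n f g i : vanishing f -> of_arity m f -> of_arity n g ->
  (0 < i <= m)%N -> vanishing (Defs.pcomp f i g).
Proof.
move=> van_f /of_arityP ar_f /of_arityP ar_g i_bnd s j.
rewrite pairing_pcomp pairing_exchange; apply: pairing_eq0 => q /ar_g ar_q.
have [size_s|size_s] := eqVneq (m + n).-1 (size s); last first.
  apply: pairing_eq0 => p /ar_f ar_p.
  by rewrite arity_tcomp ar_p // ar_q (negPf size_s) mul0r.
have [|s1 [s23 [sE size1 size23]]] :=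
  @split_size _ s i.-1 (n + (m - i)); first by lia.
have [s2 [s3 [s23E size2 size3]]] := split_size size23.
rewrite -[RHS](van_f (s1 ++ eval q s2 :: s3) j); apply: eq_pairing => p /ar_f ar_p.
have [|||K [_ evK subK]] := @eval_slot p i s1 s3; rewrite ?ar_p //.
rewrite arity_tcomp ar_p // ar_q size_s sE s23E subK ?size2 // -evK eqxx.
by rewrite size_cat /= size1 size3 (_ : (_ == _) = true) //; lia.
Qed.

Lemma vanishing_pcompr m n f g i : vanishing f -> of_arity m f -> of_arity n g ->
  (0 < i <= n)%N -> vanishing (Defs.pcomp g i f).
Proof.
move=> van_f /of_arityP ar_f /of_arityP ar_g i_bnd s j.
rewrite pairing_pcomp; apply: pairing_eq0 => p /ar_g ar_p.
have [size_s|size_s] := eqVneq (n + m).-1 (size s); last first.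
  apply: pairing_eq0 => q /ar_f ar_q.
  by rewrite arity_tcomp ar_p // ar_q (negPf size_s) mul0r.
have [|s1 [s23 [sE size1 size23]]] :=
  @split_size _ s i.-1 (m + (n - i)); first by lia.
have [s2 [s3 [s23E size2 size3]]] := split_size size23.
have [|||K [linK _ subK]] := @eval_slot p i s1 s3; rewrite ?ar_p //.
transitivity (pairing (fun q => K (eval q s2) j) f).
  apply: eq_pairing => q /ar_f ar_q.
  by rewrite arity_tcomp ar_p // ar_q size_s eqxx mul1r sE s23E subK ?ar_q.
rewrite linear_map_pairing // linear_map0 // => k.
rewrite -[RHS](van_f s2 k); apply: eq_pairing => q /ar_f ar_q.
by rewrite ar_q size2 eqxx mul1r.
Qed.

Lemma vanishing_ideal : operad_ideal vanishing.
Proof.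
split.
- by move=> s i; rewrite pairing0.
- by move=> f g van_f van_g s i; rewrite pairingD van_f van_g addr0.
- by move=> c f van_f s i; rewrite pairingZ van_f mulr0.
- move=> n f van_f s i; rewrite pairing_component.
  have [->|neq] := eqVneq n (size s).
    rewrite -[RHS](van_f s i); apply: eq_pairing => p _.
    by case: eqP; rewrite ?mul1r ?mul0r.
  apply: pairing_eq0 => p _; have [->|_] := eqVneq (arity p) n.
    by rewrite (negPf neq) mul0r mulr0.
  by rewrite mul0r.
- exact: vanishing_pcompl.
- exact: vanishing_pcompr.
Qed.

Lemma vanishing_alpha : vanishing alpha.
Proof.
move=> s i; rewrite /alpha -tree_sum3 pairing_tree_sum !big_cons big_nil addr0 /=.
case: s => [|a [|b [|c [|d [|e [|? ?]]]]]]; rewrite ?mul0r ?addr0 //.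
by rewrite !mul1r addrA T_partially_associative.
Qed.

(** * Triangularity *)

Definition unit_vector : V := fun i => if i is NA 0 then 1 else 0.

Fixpoint value (p : tree) : V :=
  if p is Node a b c then T (value a) (value b) (value c) else unit_vector.

Lemma eval_value p : eval p (nseq (arity p) unit_vector) = value p.
Proof.
elim: p => // a IHa b IHb c IHc.
by rewrite [value _]/= -IHa -IHb -IHc -eval_Node ?size_nseq // -!nseqD addnA.
Qed.

Lemma arity_comb n : arity (comb n) = (1 + 2 * n)%N.
Proof. by elim: n => //= n ->; lia. Qed.

Definition below v p : Prop := forall i, v i != 0 -> path_le (normal_tree i) p.

Section Below.
Variables (v : V) (p : tree).
Hypothesis v_p : below v p.

Lemma below_P n : P v n != 0 -> path_le (comb n) p.
Proof. exact: v_p (NA n). Qed.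

Lemma below_Q n : Q v n != 0 ->
  exists2 n', n = n'.+2 & path_le (Node Leaf Leaf (comb n'.+1)) p.
Proof.
case: n => [|[|n]] Q_n; [by rewrite eqxx in Q_n..|].
by exists n => //; exact: (v_p Q_n).
Qed.

(** Both trees of weight n + 1 that contribute to R, namely L_(n+1) and      *)
(** [Leaf, L_n], are at least [Leaf, L_n].                                   *)
Lemma below_R n : R v n.+1 != 0 -> path_le (Node Leaf Leaf (comb n)) p.
Proof.
rewrite R_S; have [QR|/below_Q [n' [->]] //] := eqVneq (Q v n.+1) 0.
rewrite QR addr0 mulf_eq0 negb_or => /andP [_ /below_P].
apply: path_le_trans; case: n {QR} => [|n]; first exact: path_le_refl.
by apply: path_le_second; rewrite /= ?arity_comb; lia.
Qed.

Lemma P_arity n : P v n != 0 -> arity p = (1 + 2 * n)%N.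
Proof. by move/below_P/path_le_arity <-; rewrite arity_comb. Qed.

Lemma Q_arity n : Q v n != 0 -> (1 < n)%N /\ arity p = (1 + 2 * n)%N.
Proof.
by case/below_Q => n' -> /path_le_arity <-; rewrite /= arity_comb; lia.
Qed.

Lemma R_arity n : R v n != 0 -> (0 < n)%N /\ arity p = (1 + 2 * n)%N.
Proof.
case: n => [|n]; first by rewrite eqxx.
by move/below_R/path_le_arity <-; rewrite /= arity_comb; lia.
Qed.
End Below.

Lemma addr_neq0 (x y : F) : x + y != 0 -> x != 0 \/ y != 0.
Proof. by have [->|] := eqVneq x 0; [rewrite add0r; right | left]. Qed.

(** Every term of T either rebuilds a node from the normal trees of its      *)
(** factors, and monotonicity of Node applies, or it moves internal nodes    *)
(** out of the first or second subtree, and the first leaves decide.         *)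
Lemma below_T a b c p q r : below a p -> below b q -> below c r ->
  below (T a b c) (Node p q r).
Proof.
move=> ap bq cr.
have leaf v s : below v s -> P v 0 != 0 -> path_le Leaf s.
  by move=> vs /(below_P vs).
case=> [[|n]|n|n|n m] /= nz; first by rewrite eqxx in nz.
all: repeat (case/addr_neq0: nz => nz); move: nz.
all: rewrite ?oppr_eq0 !mulf_eq0 ?signr_eq0 /= !negb_or -?andbA => /and3P [].
- move=> /(leaf _ _ ap) Lp /(below_P bq) Lq /(leaf _ _ cr) Lr.
  exact: path_le_Node.
- move=> /(R_arity ap) [n0 arp] /(P_arity bq) arq /(P_arity cr) arr.
  by apply: path_le_first; rewrite /= ?arity_comb; lia.
- move=> /(leaf _ _ ap) Lp /(leaf _ _ bq) Lq /(below_P cr) Lr.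
  exact: (path_le_Node Lp Lq Lr).
- move=> /(P_arity ap) arp /(Q_arity bq) [_ arq] /(P_arity cr) arr.
  by apply: path_le_second; rewrite /= ?arity_comb; lia.
- move=> /(R_arity ap) [_ arp] /(P_arity bq) arq /(P_arity cr) arr.
  by apply: path_le_first; rewrite /= ?arity_comb; lia.
- move=> /(leaf _ _ ap) Lp /(leaf _ _ bq) Lq /(below_Q cr) [_ [<-] Lr].
  exact: (path_le_Node Lp Lq Lr).
- move=> /(P_arity ap) arp /(Q_arity bq) [_ arq] /(P_arity cr) arr.
  by apply: path_le_second; rewrite /= ?arity_comb; lia.
- move=> /(R_arity ap) [_ arp] /(P_arity bq) arq /(P_arity cr) arr.
  by apply: path_le_first; rewrite /= ?arity_comb; lia.
- move=> /(P_arity ap) arp /(P_arity bq) arq /(P_arity cr) arr.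
  by apply: path_le_first; rewrite /= ?arity_comb; lia.
- move=> /(P_arity ap) arp /(R_arity bq) [_ arq] /(P_arity cr) arr.
  by apply: path_le_first; rewrite /= ?arity_comb; lia.
- move=> /(leaf _ _ ap) Lp /(below_P bq) Lq /(below_R cr) Lr.
  exact: (path_le_Node Lp Lq Lr).
- move=> /(R_arity ap) [_ arp] /(P_arity bq) arq /(R_arity cr) [_ arr].
  by apply: path_le_first; rewrite /= ?arity_comb; lia.
- move=> /(P_arity ap) arp /(P_arity bq) arq /(P_arity cr) arr.
  by apply: path_le_first; rewrite /= ?arity_comb; lia.
- move=> /(P_arity ap) arp /(R_arity bq) [_ arq] /(P_arity cr) arr.
  by apply: path_le_first; rewrite /= ?arity_comb; lia.
Qed.

Lemma below_value p : below (value p) p.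
Proof.
elim: p => [|a IHa b IHb c IHc]; last exact: below_T.
by case=> [[|n]|n|n|n m] /=; rewrite ?eqxx // => _; exact: path_le_refl.
Qed.

Lemma unit_vector_coordinates n :
  [/\ P unit_vector n.+1 = 0, Q unit_vector n = 0 & R unit_vector n = 0].
Proof.
have Q0 m : Q unit_vector m = 0 by case: m => [|[]].
by split=> //; case: n => // n; rewrite R_S Q0 [P _ _]/= /P /= mulr0 addr0.
Qed.

Lemma value_diagonal i : value (normal_tree i) i = 1.
Proof.
have [PS Q0 R0] : [/\ forall n, P unit_vector n.+1 = 0,
    forall n, Q unit_vector n = 0 & forall n, R unit_vector n = 0].
  by split=> n; have [] := unit_vector_coordinates n.
have P0 : P unit_vector 0 = 1 by [].
have P_comb n : P (value (comb n)) n = 1.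
  by elim: n => // n IH; rewrite [value _]/= P_TS IH R0 P0; ring.
case: i => [n|n|n|n m]; first exact: P_comb.
- rewrite -[LHS]/(T unit_vector unit_vector (value (comb n.+1)) (NB n)).
  by move: (value _) (P_comb n.+1) => v Pv /=; rewrite Pv R0 Q0 P0; ring.
- rewrite -[LHS]/(T unit_vector unit_vector
    (T unit_vector unit_vector (value (comb n.+1))) (NC n)).
  move: (value _) (P_comb n.+1) => v Pv.
  by rewrite /= Q_TSS PS Pv !R0 !Q0 P0; ring.
- rewrite -[LHS]/(T unit_vector (value (comb n.+1))
    (T unit_vector unit_vector (value (comb m))) (ND n m)).
  move: (value (comb n.+1)) (P_comb n.+1) => u Pu.
  move: (value _) (P_comb m) => v Pv /=.
  by rewrite R_TS !PS !R0 Pu Pv P0; ring.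
Qed.

(** * Normal trees *)

Definition avoids (q : tree) : bool :=
  ~~ has (fun l => occurs (head Leaf l) q) relations.

Lemma avoids_Node a b c : avoids (Node a b c) =
  [&& ~~ has (fun l => root_matches (head Leaf l) (Node a b c)) relations,
      avoids a, avoids b & avoids c].
Proof. by rewrite /avoids -!negb_or -!has_predU. Qed.

(** The leading monomials force the first subtree of every node to be a leaf *)
(** (alpha) and the second one to be a comb (beta); eta, theta and nu bound  *)
(** the third one.                                                           *)
Lemma avoids_normal q : avoids q -> exists i, q = normal_tree i.
Proof.
elim: q => [|a _ b IHb c IHc]; first by exists (NA 0).
rewrite avoids_Node => /and4P [root _ /IHb [ib bE] /IHc [ic cE]].
case: a root => [root|] //; have {ib bE IHb} [n bE] : exists n, b = comb n.
  by case: ib bE root => [n|n|n|n m] -> //; exists n.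
move: root; rewrite bE cE; case: n {bE} => [|n].
  case: ic {cE} => [[|m]|m|m|k m] //= _; first by exists (NA 1).
  - by exists (NB m).
  - by exists (NC m).
case: ic {cE} => [[|[|m]]|m|m|k m] //= _; first by exists (NA n.+2).
- by exists (ND n 0).
- by exists (ND n m.+1).
Qed.

(** If lm f were a normal tree, its coordinate in the value of f would       *)
(** receive by triangularity no contribution from the smaller trees of f.    *)
Lemma lm_not_avoids f n : f != 0 -> of_arity n f -> vanishing f ->
  ~~ avoids (lm f).
Proof.
move=> nz_f /of_arityP ar_f van_f; apply/negP => /avoids_normal [i lmE].
have [lm_f max_f] := lm_max nz_f.
have := van_f (nseq n unit_vector) i; rewrite size_nseq.
rewrite (_ : pairing _ f = f@_(lm f)); last first.
  rewrite -pairing_coef; apply: eq_pairing => p p_f.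
  rewrite (ar_f p p_f) eqxx mul1r -(ar_f p p_f) eval_value.
  have [->|neq] := eqVneq p (lm f); first by rewrite lmE value_diagonal.
  apply/eqP; apply: contraT => /below_value; rewrite -lmE.
  case=> [E|[_ lt_p]]; first by rewrite E eqxx in neq.
  by have := max_f p p_f; rewrite lt_p.
by move/eqP; rewrite mcoeff_eq0 lm_f.
Qed.

(** * The reduced basis *)

Lemma lm_relations (charF0 : [pchar F] =i pred0) :
  {in relations, forall l, lm (tree_sum l) = head Leaf l}.
Proof.
have ordered : all (fun l => (l != [::]) &&
    all (fun q => (q == head Leaf l) || path_lt q (head Leaf l)) l) relations.
  by vm_compute.
move=> l /(allP ordered); case: l => // p l /= /andP [_ max_p].
by apply: lm_tree_sum.
Qed.

Lemma relations_groebner (charF0 : [pchar F] =i pred0) :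
  groebner_basis [fset alpha; beta; eta; theta; nu]
                 (ideal_gen [fset (alpha : LT)]).
Proof.
split=> [g /mem_relations [l l_rel ->]|f|n f nz_f If ar_f].
- have shape : all (fun l => (l != [::]) && equiarity l) relations by vm_compute.
  have /andP [nz_l eq_ar] := allP shape l l_rel; split.
    apply: contra_neq nz_l => l0; case: l l0 {l_rel eq_ar} => // p l l0.
    by have := msupp_tree_sum charF0 (p :: l) p; rewrite l0 msupp0 in_fset0 mem_head.
  exists (arity (head Leaf l)); apply: tree_sum_arity => p p_l.
  by apply/eqP; exact: (allP eq_ar).
- split=> [Ia S idealS S_G|IG S idealS S_a].
    apply: (Ia S idealS) => g; rewrite in_fset1 => /eqP ->.
    by apply: S_G; rewrite in_fset5 mem_head.
  apply: (IG S idealS) => g /mem_relations [l l_rel ->].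
  exact: relations_in_ideal (S_a _ (fset11 _)) _ l_rel.
- have van_f : vanishing f.
    apply: (If _ vanishing_ideal) => g; rewrite in_fset1 => /eqP ->.
    exact: vanishing_alpha.
  have := lm_not_avoids nz_f ar_f van_f; rewrite negbK => /hasP [l l_rel occ_l].
  exists (tree_sum l); first by apply/mem_relations; exists l.
  by rewrite lm_relations //; apply/dividesP.
Qed.

Lemma relations_reduced (charF0 : [pchar F] =i pred0) :
  reduced_groebner_basis [fset alpha; beta; eta; theta; nu]
                         (ideal_gen [fset (alpha : LT)]).
Proof.
split; first exact: relations_groebner.
- move=> g /mem_relations [l l_rel ->]; rewrite lm_relations // tree_sum_coef.
  have once : all (fun l => count_mem (head Leaf l) l == 1%N) relations.
    by vm_compute.
  by rewrite (eqP (allP once l l_rel)).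
- move=> g h p /mem_relations [l l_rel ->] /mem_relations [l' l'_rel ->] neq.
  rewrite msupp_tree_sum // lm_relations // => p_l /dividesP occ.
  have irr : all (fun l => all (fun l' => (l' == l) ||
      all (fun p => ~~ occurs (head Leaf l') p) l) relations) relations.
    by vm_compute.
  have := allP (allP irr l l_rel) l' l'_rel.
  case/predU1P => [E|/allP /(_ p p_l)]; last by rewrite occ.
  by rewrite E eqxx in neq.
Qed.

End TreePolynomials.

Theorem theorem3p1 (F : fieldType) (charF0 : [pchar F] =i pred0) :
  reduced_groebner_basis
    [fset alpha; beta; eta; theta; nu]
    (ideal_gen [fset (alpha : {malg F[tree]})])
  /\ [/\ (alpha : {malg F[tree]}) =
           << Node t Leaf Leaf >> + << Node Leaf t Leaf >>
           + << Node Leaf Leaf t >>,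
         (beta : {malg F[tree]}) =
           << Node Leaf (Node Leaf Leaf t) Leaf >>
           + << Node Leaf Leaf (Node Leaf t Leaf) >>
           + << Node Leaf Leaf (Node Leaf Leaf t) >>,
         (eta : {malg F[tree]}) =
           << Node Leaf t (Node Leaf t Leaf) >>
           + << Node Leaf t (Node Leaf Leaf t) >>,
         (theta : {malg F[tree]}) = << Node Leaf Leaf (Node Leaf t t) >>
       & (nu : {malg F[tree]}) =
           << Node Leaf Leaf (Node Leaf Leaf (Node Leaf Leaf t)) >>].
Proof.
split; first exact: relations_reduced.
by split.
Qed.
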